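(* Let $X$ be a set with $|X|\ge 3$ and let $n\ge 2$ be an integer. If $F\in\mathcal{F}^n_{n-1}\setminus\mathcal{F}^n_1$, then, setting $Y=E_F$, we have $|Y|\ge 3$ and the following assertions hold. (a) $(Y,F|_{Y^n})$ is the $n$-ary extension of an Abelian group whose exponent divides $n-1$. (b) $F|_{(X\setminus Y)^n}$ is associative, quasitrivial, and has at most one neutral element. (c) For all $x_1,\ldots,x_n\in X$ and $i\in\{1,\ldots,n-1\}$ such that $\{x_i,x_{i+1}\}\cap(X\setminus Y)=\{x\}$ (a singleton) we have $F(x_1,\ldots,x_n)=F(x_1,\ldots,x_{i-1},x,x,x_{i+2},\ldots,x_n)$. Conversely, if an operation $F\colon X^n\to X$ satisfies conditions (a), (b), (c) for some $Y\subseteq X$ with $|Y|\ge 3$, then $F\in\mathcal{F}^n_{n-1}\setminus\mathcal{F}^n_1$ and $E_F=Y$.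
   Context: Notation: $k\boldsymbol{\cdot} x$ stands for the $k$-tuple $x,\ldots,x$. An operation $F\colon X^n\to X$ is associative if $F(x_1,\ldots,x_{i-1},F(x_i,\ldots,x_{i+n-1}),x_{i+n},\ldots,x_{2n-1})=F(x_1,\ldots,x_i,F(x_{i+1},\ldots,x_{i+n}),x_{i+n+1},\ldots,x_{2n-1})$ for all $x_1,\ldots,x_{2n-1}\in X$ and $1\le i\le n-1$. For $k\in\{1,\ldots,n\}$, $\mathcal{F}^n_k$ is the class of associative operations $F\colon X^n\to X$ such that $F(x_1,\ldots,x_n)\in\{x_1,\ldots,x_n\}$ whenever at least $k$ of the components $x_1,\ldots,x_n$ are equal to each other. An operation is quasitrivial if $F(x_1,\ldots,x_n)\in\{x_1,\ldots,x_n\}$ for all arguments; so $\mathcal{F}^n_1$ is the class of quasitrivial associative $n$-ary operations. An element $e$ is neutral for an operation $F\colon X^n\to X$ if $F((k-1)\boldsymbol{\cdot} e,x,(n-k)\boldsymbol{\cdot} e)=x$ for all $x\in X$ and $k\in\{1,\ldots,n\}$; $E_F$ is the set of neutral elements of $F$. For a binary associative $G$ on a set $Y$, define $G^1=G$ and $G^m(x_1,\ldots,x_{m+1})=G^{m-1}(x_1,\ldots,x_{m-1},G(x_m,x_{m+1}))$ for $m\ge 2$; $(Y,G^{n-1})$ is called the $n$-ary extension of $(Y,G)$. The exponent of a group is the smallest integer $r\ge 1$ (if any) such that the $r$-th power of every element is the neutral element. In (a) and (b), the restrictions are understood as operations on $Y$ and on $X\setminus Y$ respectively (that is, $F(Y^n)\subseteq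 Y$ and $F((X\setminus Y)^n)\subseteq X\setminus Y$), and neutral elements in (b) are those of the restricted operation on $X\setminus Y$. *)

(* Defs.v *)
From mathcomp Require Import all_boot.
From mathcomp Require Import boolp classical_sets functions cardinality.

Set Implicit Arguments.
Unset Strict Implicit.
Unset Printing Implicit Defensive.

Local Open Scope classical_set_scope.

Section Operations.
Variables (T : Type) (n : nat).
Implicit Types F : T ^ n -> T.

(* Indices start at 0.  The arguments x_1, ..., x_(2n-1) are the first 2n-1
   terms of a sequence [x : nat -> T]; the other terms are not used. *)
Definition nested F (x : nat -> T) (i : nat) : T :=
  F [ffun j : 'I_n =>
       if j < i then x j
       else if j == i :> nat then F [ffun l : 'I_n => x (i + l)]
       else x (j + n.-1)].

Definition nary_associative F : Prop :=
  forall (x : nat -> T) (i : nat), i.+1 < n -> nested F x i = nested F x i.+1.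

Definition at_least_equal (k : nat) (x : T ^ n) : Prop :=
  exists2 A : {set 'I_n}, k <= #|A| &
    forall i j, i \in A -> j \in A -> x i = x j.

Definition class_F (k : nat) F : Prop :=
  nary_associative F /\
  forall x : T ^ n, at_least_equal k x -> exists i : 'I_n, F x = x i.

Definition quasitrivial F : Prop :=
  forall x : T ^ n, exists i : 'I_n, F x = x i.

Definition neutral F (e : T) : Prop :=
  forall (x : T) (k : 'I_n), F [ffun j => if j == k then x else e] = x.

Definition neutral_set F : set T := [set e | neutral F e].

(* [H] is F restricted to A^n, as an operation on A; such an [H] exists iff
   F(A^n) is included in A, and it is then unique. *)
Definition restricts_to F (A : set T) (H : set_type A ^ n -> set_type A) : Prop :=
  forall x : set_type A ^ n, \val (H x) = F [ffun i => \val (x i)].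

End Operations.

Section BinaryOperations.
Variables (T : Type) (G : T -> T -> T).

(* [binary_iter m x] is G^m(x_0, ..., x_m); the convention G^0(x_0) = x_0
   yields G^1 = G. *)
Fixpoint binary_iter (m : nat) (x : nat -> T) : T :=
  if m is m'.+1 then
    binary_iter m' (fun j => if j < m' then x j else G (x m') (x m'.+1))
  else x 0.

(* Every element of T^n is the restriction to 'I_n of a sequence nat -> T,
   as long as n > 0. *)
Definition nary_extension (n : nat) (F : T ^ n -> T) : Prop :=
  forall x : nat -> T, F [ffun i : 'I_n => x i] = binary_iter n.-1 x.

Definition abelian_group (e : T) : Prop :=
  [/\ associative G, commutative G, left_id e G &
      exists inv : T -> T, left_inverse e inv G].

Definition kills (e : T) (r : nat) : Prop := forall x : T, iter r (G x) e = e.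

Definition is_exponent (e : T) (r : nat) : Prop :=
  [/\ 0 < r, kills e r & forall s, 0 < s -> kills e s -> r <= s].

End BinaryOperations.

Section Conditions.
Variables (X : Type) (n : nat) (F : X ^ n -> X) (Y : set X).

Definition group_extension_on : Prop :=
  exists2 H : set_type Y ^ n -> set_type Y, restricts_to F H &
    exists (G : set_type Y -> set_type Y -> set_type Y) (e : set_type Y)
           (r : nat),
      [/\ abelian_group G e, is_exponent G e r, r %| n.-1 & nary_extension G H].

Definition quasitrivial_off : Prop :=
  exists2 H : set_type (~` Y) ^ n -> set_type (~` Y), restricts_to F H &
    [/\ nary_associative H, quasitrivial H & is_subset1 (neutral_set H)].

Definition outer_neighbour_dominates : Prop :=
  forall (x : X ^ n) (i j : 'I_n) (a : X), j = i.+1 :> nat ->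
    [set x i; x j] `&` ~` Y = [set a] ->
    F x = F [ffun k => if (k == i) || (k == j) then a else x k].

End Conditions.

(* Main.v *)
(** In the semigroup generated by [X] with the relations of [F], every power
    [a^(n-1)] is idempotent, and if at least [n - 1] equal arguments force a
    quasitrivial value, these idempotents multiply quasitrivially. Hence for
    [a <> b] either [ab] can be replaced by [aa] or by [bb] in every argument
    list, or [a^(n-1) = b^(n-1)], in which case [a] and [b] are both neutral.
    An argument list with a non-neutral entry therefore collapses to a constant
    list of one of its non-neutral entries, so a failure of quasitriviality
    takes place among the neutral elements. A neutral element reduces [F] to a
    monoid, in which the neutral elements of [F] are the central elements
    killed by [n - 1].

    Conversely, (c) and the same collapse on the outer part show that
    [(x, y) |-> F (x, e, ..., e, y)], with [e] the unit of the group, is an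
    associative operation with [n]-ary extension [F]. *)

Require Import Defs.
From mathcomp Require Import all_boot zify.
From mathcomp Require Import boolp classical_sets functions cardinality.

Set Implicit Arguments.
Unset Strict Implicit.
Unset Printing Implicit Defensive.

Local Open Scope classical_set_scope.
Local Open Scope card_scope.

(** Argument lists become words, which can be cut and concatenated. Only the first [n] letters
    count, and [x0] pads a shorter word. *)
Definition eval_word (T : Type) (n : nat) (x0 : T) (F : T ^ n -> T)
  (w : seq T) : T := F [ffun i : 'I_n => nth x0 w i].

(** The codomain [S] is arbitrary so that [Phi] can also be a pair of two evaluations, which then
    collapse in step. *)
Definition merges (T S : Type) (n : nat) (Phi : seq T -> S) (a b c : T) :=
  forall u v, size u + size v + 2 = n ->
    Phi (u ++ a :: b :: v) = Phi (u ++ c :: c :: v).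

Lemma nseqS_cat (T : Type) k (z : T) s : nseq k.+1 z ++ s = nseq k z ++ z :: s.
Proof. by elim: k => //= k <-. Qed.

(** * Collapsing words by merging neighbouring letters *)

Section Merging.
Variables (T : eqType) (S : Type) (n : nat) (Phi : seq T -> S).
Implicit Types (a b c z : T) (u v w s : seq T).

Lemma merges_refl a : merges n Phi a a a.
Proof. by []. Qed.

(** Each merge at the border of the two runs moves the border by one letter into the run that does
    not survive; the induction is on the length of that run. *)
Lemma merge_runs a b c k l u v : merges n Phi a b c -> c \in [:: a; b] ->
    0 < k -> 0 < l -> size u + k + l + size v = n ->
  Phi (u ++ nseq k a ++ nseq l b ++ v) = Phi (u ++ nseq (k + l) c ++ v).
Proof.
move=> mab; rewrite !inE => /orP[]/eqP cE k0 l0; rewrite {}cE in mab *.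
  elim: l k l0 k0 => // l IH [//|k] _ _ sz.
  have -> : u ++ nseq k.+1 a ++ nseq l.+1 b ++ v =
      (u ++ nseq k a) ++ a :: b :: nseq l b ++ v.
    by rewrite nseqS_cat -!catA.
  rewrite mab; last by rewrite !size_cat !size_nseq; lia.
  rewrite -catA -!nseqS_cat; case: l IH sz => [_ _|l IH sz]; first by rewrite addn1.
  by rewrite IH //; [congr (Phi (u ++ nseq _ a ++ _)); lia|lia].
elim: k l l0 k0 => // k IH [//|l] _ _ sz.
have -> : u ++ nseq k.+1 a ++ nseq l.+1 b ++ v =
    (u ++ nseq k a) ++ a :: b :: nseq l b ++ v.
  by rewrite nseqS_cat -!catA.
rewrite mab; last by rewrite !size_cat !size_nseq; lia.
rewrite -catA; case: k IH sz => [_ _ //|k IH sz].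
by rewrite (IH l.+2) //; [congr (Phi (u ++ nseq _ b ++ _)); lia|lia].
Qed.

(** A constant prefix meets the next letter and either absorbs it or takes its value throughout. In
    both cases the prefix stays constant and grows by one. *)
Lemma merge_to_constant (P : pred T) w :
    (forall a b, P a -> P b -> exists2 c, c \in [:: a; b] & merges n Phi a b c) ->
    size w = n -> 0 < n -> all P w ->
  exists2 z, z \in w & Phi w = Phi (nseq n z).
Proof.
move=> mrg; case: w => [<- //|a s] /= sz _ /andP[Pa Ps].
suff: forall k, 0 < k -> k + size s = n ->
    exists2 z, z \in a :: s & Phi (nseq k a ++ s) = Phi (nseq n z).
  by move=> /(_ 1); apply; lia.
elim: s a Pa Ps {sz} => [|b s IH] a Pa /= Ps k k0 sz.
  by exists a; [rewrite mem_head|rewrite cats0 -sz addn0].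
have /andP[Pb {}Ps] := Ps.
have [c cab mab] := mrg a b Pa Pb.
have Pc : P c by move: cab; rewrite !inE => /orP[]/eqP->.
have [z zcs Pz] := IH c Pc Ps (k + 1) ltac:(lia) ltac:(lia).
exists z.
  move: zcs cab; rewrite !inE => /orP[/eqP ->|->]; last by rewrite !orbT.
  by move=> /orP[]->; rewrite ?orbT.
rewrite -Pz; have -> : b :: s = nseq 1 b ++ s by [].
by rewrite (@merge_runs _ _ _ _ _ [::] _ mab) //= -?sz /=; lia.
Qed.

(** Letters in [P] spread over their neighbours outside [P]: leftwards from a tail that contains
    one, rightwards from the head otherwise. *)
Lemma merge_absorbed (P : pred T) w :
    (forall a b, P a -> ~~ P b -> merges n Phi a b a /\ merges n Phi b a a) ->
    size w = n -> has P w ->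
  exists w', [/\ size w' = n, {subset w' <= w}, all P w' & Phi w = Phi w'].
Proof.
move=> absb sz hw.
(* An arbitrary context [u], [v] of the right total length is allowed, so that the induction
   hypothesis applies to the tail inside the full word. *)
suff [w' [sz' sub allw eqw]] : exists w', [/\ size w' = size w, {subset w' <= w},
    all P w' & forall u v, size u + size w + size v = n ->
    Phi (u ++ w ++ v) = Phi (u ++ w' ++ v)].
  exists w'; split=> //; first by rewrite sz'.
  by have := eqw [::] [::]; rewrite !cats0; apply; rewrite /= sz addn0.
elim: w hw {sz} => // a s IH /= has_as.
have [hs|nhs] := boolP (has P s).
  have {IH} [[|b w'] [sz' sub allw eqw]] := IH hs.
    by case: s hs sz' {has_as sub eqw}.
  have := allw => /= /andP[Pb _].
  (* The head keeps its letter if that is in [P]; otherwise the first letter of the collapsed tail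
     absorbs it. *)
  pose c := if P a then a else b.
  exists (c :: b :: w'); split => [|x|//=|u v su].
  - by rewrite /= -sz'.
  - rewrite inE => /orP[/eqP ->|/sub]; last by rewrite inE orbC => ->.
    rewrite /c; case: ifP => _; first by rewrite mem_head.
    by rewrite inE sub ?mem_head ?orbT.
  - by rewrite /= in allw; rewrite allw /c andbT; case: ifP.
  - rewrite cat_cons -cat_rcons eqw; last by rewrite size_rcons; move: su => /=; lia.
    rewrite cat_rcons /= /c; case: ifPn => // Pa.
    have [_ mab] := absb b a Pb Pa; rewrite mab //.
    by move: su; rewrite /= -sz' size_cat /=; lia.
have Pa : P a by case/orP: has_as => // hs; rewrite hs in nhs.
(* No letter of the tail is in [P], so the head overwrites all of it. *)
exists (nseq (size s).+1 a); split => [|x|/=|].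
- by rewrite size_nseq.
- by move=> /nseqP[-> _]; rewrite mem_head.
- by rewrite Pa all_nseq Pa orbT.
rewrite /= {IH has_as}; elim: s nhs => //= b s IH.
rewrite negb_or => /andP[Pb hs] u v su.
have [mab _] := absb a b Pa Pb.
rewrite mab; last by rewrite size_cat; lia.
rewrite -cat_rcons -!cat_cons IH //; last by rewrite size_rcons; lia.
by rewrite cat_rcons.
Qed.
End Merging.

(** * Products of words under an associative binary operation *)

Section Fold.
Variables (T : Type) (x0 : T) (G : T -> T -> T).
Hypothesis GA : associative G.

Definition fold1 (w : seq T) : T := if w is a :: s then foldl G a s else x0.

Lemma foldl_op a b s : foldl G (G a b) s = G a (foldl G b s).
Proof. by elim: s b => //= c s IH b; rewrite -GA IH. Qed.

Lemma fold1_cat u w v : 0 < size w ->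
  fold1 (u ++ fold1 w :: v) = fold1 (u ++ w ++ v).
Proof.
case: w => // b w _; case: u => [|a u] /=; first by rewrite foldl_cat.
by rewrite !foldl_cat /= foldl_cat (foldl_op _ b w).
Qed.

Lemma fold1_nseq k a : G a a = a -> fold1 (nseq k.+1 a) = a.
Proof. by move=> aa /=; elim: k => //= k; rewrite aa. Qed.

(** If [c = G a b] is idempotent, the factors [ab] and [cc] both have product [c]. *)
Lemma fold1_merges n a b : G (G a b) (G a b) = G a b ->
  merges n fold1 a b (G a b).
Proof.
move=> cc u v _.
by rewrite -(@fold1_cat u [:: a; b] v) // -(@fold1_cat u [:: G a b; G a b] v) //= cc.
Qed.

(** The recursion replaces the last two letters by their product, which [fold1_cat] undoes. *)
Lemma binary_iterE m x : binary_iter G m x = fold1 (mkseq x m.+1).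
Proof.
elim: m x => // m IH x; rewrite [LHS]/= IH.
have -> : mkseq x m.+2 = mkseq x m ++ [:: x m; x m.+1].
  by rewrite /mkseq -addn2 iotaD map_cat.
have -> : mkseq (fun j => if j < m then x j else G (x m) (x m.+1)) m.+1 =
    mkseq x m ++ [:: G (x m) (x m.+1)].
  rewrite /mkseq -addn1 iotaD map_cat /= add0n ltnn.
  by congr (_ ++ _); apply/eq_in_map => j; rewrite mem_iota add0n => /= ->.
by have := @fold1_cat (mkseq x m) [:: x m; x m.+1] [::]; rewrite !cats0 /=; apply.
Qed.
End Fold.

(** * Associativity and neutrality expressed on words *)

Section EvalWord.
Variables (T : Type) (n : nat) (x0 : T) (F : T ^ n -> T).
Implicit Types (a b : T) (u v w : seq T).
Local Notation Fs := (eval_word x0 F).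

Lemma eval_fgraph x : F x = Fs (fgraph x).
Proof. by congr F; apply/ffunP => i; rewrite ffunE nth_fgraph_ord. Qed.

Lemma eval_mkseq (f : nat -> T) : F [ffun i : 'I_n => f i] = Fs (mkseq f n).
Proof. by congr F; apply/ffunP => i; rewrite !ffunE nth_mkseq. Qed.

Lemma nested_cat u w v : size w = n -> size u + size v + 1 = n ->
  nested F (nth x0 (u ++ w ++ v)) (size u) = Fs (u ++ Fs w :: v).
Proof.
move=> sw suv; congr F; apply/ffunP => j; rewrite !ffunE.
rewrite [RHS]nth_cat !nth_cat; case: ltngtP => // [lt_uj|->].
  have -> : (j + n.-1 < size u) = false by lia.
  have -> : (j + n.-1 - size u < size w) = false by have := ltn_ord j; lia.
  have -> : j - size u = (j - size u).-1.+1 by lia.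
  by rewrite /= sw; congr nth; have := ltn_ord j; lia.
rewrite subnn /=; congr F; apply/ffunP => l; rewrite !ffunE nth_cat.
by rewrite ltnNge leq_addr /= addKn nth_cat sw ltn_ord.
Qed.

(** Associativity only compares adjacent positions of the inner operation; by induction every
    position agrees with position 0. *)
Lemma eval_wordA u w v u' w' v' : nary_associative F ->
    size w = n -> size u + size v + 1 = n ->
    size w' = n -> size u' + size v' + 1 = n ->
    u ++ w ++ v = u' ++ w' ++ v' ->
  Fs (u ++ Fs w :: v) = Fs (u' ++ Fs w' :: v').
Proof.
move=> FA sw suv sw' suv'; rewrite -!nested_cat // => ->.
have nest0 i : i < n ->
    nested F (nth x0 (u' ++ w' ++ v')) i = nested F (nth x0 (u' ++ w' ++ v')) 0.
  by elim: i => // i IH lt_in; rewrite -FA // IH // ltnW.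
by rewrite (nest0 (size u)) 1?(nest0 (size u')) //; lia.
Qed.

(** Wherever the inner operation stands, the nested value is the [G]-product of the same word [t] of
    2n-1 letters. *)
Lemma associative_of_fold1 (G : T -> T -> T) : 0 < n -> associative G ->
    (forall w, size w = n -> Fs w = fold1 x0 G w) ->
  nary_associative F.
Proof.
move=> n0 GA FE x i lt_in.
pose t := mkseq x (n + n.-1).
suff nestE k : k < n -> nested F x k = fold1 x0 G t by rewrite !nestE // ltnW.
move=> lt_kn.
have st : size t = n + n.-1 by rewrite size_mkseq.
have -> : nested F x k = nested F (nth x0 t) k.
  congr F; apply/ffunP => j; rewrite !ffunE; have ltj := ltn_ord j.
  case: ifP => // _; first by rewrite nth_mkseq //; lia.
  case: ifP => // _; last by rewrite nth_mkseq //; lia.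
  congr F; apply/ffunP => l; rewrite !ffunE nth_mkseq //.
  by have := ltn_ord l; lia.
have tE : t = take k t ++ take n (drop k t) ++ drop n (drop k t).
  by rewrite !cat_take_drop.
have su : size (take k t) = k by rewrite size_take st; case: ltnP; lia.
have sw : size (take n (drop k t)) = n.
  by rewrite size_take size_drop st; case: ltnP; lia.
have sv : k + size (drop n (drop k t)) + 1 = n by rewrite !size_drop st; lia.
move: (take k t) (take n (drop k t)) (drop n (drop k t)) tE su sw sv => u w v.
move=> -> <- sw sv; rewrite nested_cat // !FE //; last by rewrite size_cat /= ; lia.
by rewrite fold1_cat // sw.
Qed.

Lemma neutralE e : neutral F e <->
  forall p q x, p + q + 1 = n -> Fs (nseq p e ++ x :: nseq q e) = x.
Proof.
have E x (k : 'I_n) q : k + q + 1 = n ->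
    F [ffun j => if j == k then x else e] = Fs (nseq k e ++ x :: nseq q e).
  move=> kq; congr F; apply/ffunP => j; rewrite !ffunE nth_cat size_nseq.
  case: (ltngtP j k) => [ltjk|ltkj|/val_inj ->].
  - by rewrite nth_nseq ltjk -val_eqE /= ltn_eqF.
  - rewrite -val_eqE /= gtn_eqF //; have -> : j - k = (j - k).-1.+1 by lia.
    by rewrite /= nth_nseq; case: ifP => //; have := ltn_ord j; lia.
  - by rewrite eqxx subnn.
split=> [eF p q x pq|eF x k].
  by have lt_pn : p < n by [lia]; rewrite -(@E x (Ordinal lt_pn)) // eF.
by rewrite (@E x k (n - k.+1)); [apply: eF|]; have := ltn_ord k; lia.
Qed.

End EvalWord.

(** * Operations that are quasitrivial on nearly constant words *)

Section NearlyConstant.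
Variables (T : eqType) (n : nat) (x0 : T) (F : T ^ n -> T).
Implicit Types (a b c e x y : T) (u v w : seq T).
Local Notation Fs := (eval_word x0 F).
Hypotheses (n2 : 2 <= n) (hF : class_F n.-1 F).

Lemma class_eval p q a b : p + q + 1 = n ->
  Fs (nseq p a ++ b :: nseq q a) \in [:: a; b].
Proof.
move=> pq; have lt_pn : p < n by lia.
pose w := nseq p a ++ b :: nseq q a.
have wE i : i < n -> nth x0 w i = if i == p then b else a.
  move=> ltin; rewrite nth_cat size_nseq; case: ltngtP => [lti|lti|->].
  - by rewrite nth_nseq lti.
  - have -> : i - p = (i - p).-1.+1 by lia.
    by rewrite /= nth_nseq; case: ifP => //; lia.
  - by rewrite subnn.
have [_ /(_ [ffun i : 'I_n => nth x0 w i]) []] := hF.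
  exists (~: [set Ordinal lt_pn])%SET; first by rewrite cardsC1 card_ord.
  move=> i j; rewrite !inE -!val_eqE /= !ffunE !wE //.
  by move=> /negPf-> /negPf->.
move=> i; rewrite /eval_word => ->; rewrite ffunE wE // !inE.
by case: ifP; rewrite eqxx ?orbT.
Qed.

Lemma eval_nseq a : Fs (nseq n a) = a.
Proof.
have -> : nseq n a = nseq n.-1 a ++ [:: a]
  by case: (n) n2 => // k _; rewrite -nseqS_cat cats0.
by have := @class_eval n.-1 0 a a ltac:(lia); rewrite !inE orbb => /eqP.
Qed.

(** Writing the letter [a] as the value of a^n gives ab = a^n b = a (a^(n-1) b) = aa inside any
    word. *)
Lemma merges_left a b : Fs (nseq n.-1 a ++ [:: b]) = a -> merges n Fs a b a.
Proof.
move=> ab u v suv; rewrite -{1}[a]eval_nseq.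
rewrite (@eval_wordA _ _ _ _ u _ (b :: v) (rcons u a) (nseq n.-1 a ++ [:: b]) v hF.1).
- by rewrite ab cat_rcons.
- by rewrite size_nseq.
- by rewrite /=; lia.
- by rewrite size_cat size_nseq /=; lia.
- by rewrite size_rcons; lia.
- by rewrite cat_rcons -catA; case: (n) n2.
Qed.

(** Mirror image: ab = a b^n = (a b^(n-1)) b = bb. *)
Lemma merges_right a b : Fs (a :: nseq n.-1 b) = b -> merges n Fs a b b.
Proof.
move=> ab u v suv; rewrite -cat_rcons -{1}[b]eval_nseq.
rewrite (@eval_wordA _ _ _ _ (rcons u a) _ v u (a :: nseq n.-1 b) (b :: v) hF.1).
- by rewrite ab.
- by rewrite size_nseq.
- by rewrite size_rcons; lia.
- by rewrite /= size_nseq; lia.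
- by rewrite /=; lia.
- by rewrite cat_rcons; case: (n) n2 => // k _; rewrite nseqS_cat.
Qed.

Lemma merges_eval a b c p q : merges n Fs a b c -> c \in [:: a; b] ->
  0 < p -> 0 < q -> p + q = n -> Fs (nseq p a ++ nseq q b) = c.
Proof.
move=> mab cab p0 q0 pq.
have := @merge_runs _ _ _ _ _ _ _ p q [::] [::] mab cab p0 q0.
by rewrite /= !cats0 addn0 pq eval_nseq => ->.
Qed.

(** A word e^p x e^q has value [x] or [e]. In the second case e = e^q (e^p x e^q) e^p = (e^(n-1) x)
    e^(n-1) = x, so the value is [x] anyway. *)
Lemma neutral_lr e : (forall x, Fs (nseq n.-1 e ++ [:: x]) = x) ->
  (forall x, Fs (x :: nseq n.-1 e) = x) -> neutral F e.
Proof.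
move=> el er; apply/(neutralE x0) => p q x pq.
have := @class_eval p q e x pq; rewrite !inE => /orP[]/eqP // pqE.
suff xE : Fs (nseq q e ++ e :: nseq p e) = x.
  rewrite pqE -[LHS]eval_nseq -xE; congr Fs.
  by rewrite -nseqS_cat -nseqD; congr nseq; lia.
rewrite -[X in _ ++ X :: _]pqE (@eval_wordA _ _ _ _ _ _ _
  [::] (nseq n.-1 e ++ [:: x]) (nseq n.-1 e) hF.1).
- by rewrite el /= er.
- by rewrite size_cat /= !size_nseq; lia.
- by rewrite !size_nseq; lia.
- by rewrite size_cat /= !size_nseq; lia.
- by rewrite !size_nseq /=; lia.
have -> : n.-1 = q + p by lia.
by rewrite !nseqD -!catA.
Qed.

(* When neither merge happens, e = a^(n-1) and f = b^(n-1) act in the same way,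
   e = ef = f, so a^(n-1) x lies in both {a, x} and {b, x}. *)
Lemma merges_or_neutral a b : a != b ->
  [\/ merges n Fs a b a, merges n Fs a b b | neutral F a /\ neutral F b].
Proof.
move=> neq_ab.
have eval_l x y : Fs (nseq n.-1 x ++ [:: y]) \in [:: x; y].
  by apply: (@class_eval n.-1 0); lia.
have eval_r x y : Fs (x :: nseq n.-1 y) \in [:: y; x].
  by apply: (@class_eval 0 n.-1); lia.
have := eval_l a b; rewrite !inE => /orP[]/eqP abL.
  by constructor 1; apply: merges_left.
have := eval_r a b; rewrite !inE => /orP[]/eqP abR.
  by constructor 2; apply: merges_right.
constructor 3.
have nE c : nseq n.-1 c = c :: nseq n.-2 c by case: (n) n2 => [|[]].
have nE' c : nseq n.-1 c = nseq n.-2 c ++ [:: c].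
  by case: (n) n2 => [|[|k]] // _; rewrite -nseqS_cat cats0.
(* Here a^(n-1) b = b and a b^(n-1) = a, so a^(n-1) b^(n-1) x evaluates to either side. *)
have Lab x : Fs (nseq n.-1 a ++ [:: x]) = Fs (nseq n.-1 b ++ [:: x]).
  transitivity (Fs (nseq n.-1 a ++ [:: Fs (nseq n.-1 b ++ [:: x])])).
    rewrite [in RHS](@eval_wordA _ _ _ _ _ _ _
      (nseq n.-2 a) (a :: nseq n.-1 b) [:: x] hF.1) ?abR.
    + by rewrite nE' -catA.
    + by rewrite size_cat size_nseq /=; lia.
    + by rewrite size_nseq /=; lia.
    + by rewrite /= size_nseq; lia.
    + by rewrite size_nseq /=; lia.
    + by rewrite cats0 {1}nE' -!catA.
  rewrite (@eval_wordA _ _ _ _ _ _ _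
    [::] (nseq n.-1 a ++ [:: b]) (nseq n.-2 b ++ [:: x]) hF.1) ?abL.
  + by rewrite nE.
  + by rewrite size_cat size_nseq /=; lia.
  + by rewrite size_nseq /=; lia.
  + by rewrite size_cat size_nseq /=; lia.
  + by rewrite size_cat size_nseq /=; lia.
  + by rewrite cats0 [in LHS](nE b) -!catA.
have Rab x : Fs (x :: nseq n.-1 a) = Fs (x :: nseq n.-1 b).
  transitivity (Fs (Fs (x :: nseq n.-1 a) :: nseq n.-1 b)).
    rewrite [in RHS](@eval_wordA _ _ _ _ [::] _ _
      (x :: nseq n.-2 a) (a :: nseq n.-1 b) [::] hF.1) ?abR.
    + by rewrite [in LHS]nE'.
    + by rewrite /= size_nseq; lia.
    + by rewrite size_nseq /=; lia.
    + by rewrite /= size_nseq; lia.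
    + by rewrite /= size_nseq; lia.
    + by rewrite cats0 /= {1}nE' -!catA.
  rewrite (@eval_wordA _ _ _ _ [::] _ _
    [:: x] (nseq n.-1 a ++ [:: b]) (nseq n.-2 b) hF.1) ?abL.
  + by rewrite [in RHS]nE.
  + by rewrite /= size_nseq; lia.
  + by rewrite size_nseq /=; lia.
  + by rewrite size_cat size_nseq /=; lia.
  + by rewrite size_nseq /=; lia.
  + by rewrite [in LHS](nE b) /= -!catA.
have both x y : x \in [:: a; y] -> x \in [:: b; y] -> x = y.
  rewrite !inE => /orP[]/eqP -> // /orP[]/eqP // ab.
  by rewrite ab eqxx in neq_ab.
have nl x : Fs (nseq n.-1 a ++ [:: x]) = x by apply: both; rewrite // Lab.
have nr x : Fs (x :: nseq n.-1 a) = x.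
  by apply: both; [|rewrite Rab]; have := eval_r x a; have := eval_r x b.
by split; apply: neutral_lr => // x; rewrite -?Lab -?Rab.
Qed.

(** The survivor of a merge of distinct letters is never neutral: a run of n-1 survivors next to the
    other letter evaluates to the survivor by merging, but to the other letter by neutrality. *)
Lemma merges_not_neutral a b : ~ (neutral F a /\ neutral F b) ->
  exists2 c, c \in [:: a; b] & merges n Fs a b c /\ ~ neutral F c.
Proof.
move=> nab; have [ab|neq_ab] := eqVneq a b.
  exists a; first exact: mem_head.
  split; first by rewrite ab; apply: merges_refl.
  by move=> na; apply: nab; rewrite -ab.
have [mab|mab|//] := merges_or_neutral neq_ab.
  exists a; first exact: mem_head.
  split=> // /(neutralE x0) na.
  have := @merges_eval _ _ _ n.-1 1 mab (mem_head _ _) ltac:(lia) isT ltac:(lia).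
  by rewrite /=; have /= -> := na n.-1 0 b ltac:(lia); apply/eqP; rewrite eq_sym.
have bab : b \in [:: a; b] by rewrite !inE eqxx orbT.
exists b => //; split=> // /(neutralE x0) nb.
have := @merges_eval _ _ _ 1 n.-1 mab bab isT ltac:(lia) ltac:(lia).
rewrite /=; have /= -> := nb 0 n.-1 a ltac:(lia).
by apply/eqP.
Qed.

(** Every word a^p b^q with p, q > 0 has as value the letter into which [a] and [b] merge, hence
    a^(n-1) b, taken as G(a, b). This serves the quasitrivial part in the converse. *)
Lemma reducible_of_merges :
    (forall a b, exists2 c, c \in [:: a; b] & merges n Fs a b c) ->
  exists G, [/\ associative G, forall a b, G a b \in [:: a; b],
    forall a b, Fs (nseq n.-1 a ++ [:: b]) = G a b &
    forall w, size w = n -> Fs w = fold1 x0 G w].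
Proof.
move=> mrg; pose G a b := Fs (nseq n.-1 a ++ [:: b]).
have GE a b p q : 0 < p -> 0 < q -> p + q = n ->
    Fs (nseq p a ++ nseq q b) = G a b.
  move=> p0 q0 pq; have [c cab mab] := mrg a b.
  rewrite (@merges_eval _ _ c p q) // /G.
  by rewrite (@merges_eval _ _ c n.-1 1) //; lia.
have GP a b : G a b \in [:: a; b] /\ merges n Fs a b (G a b).
  have [c cab mab] := mrg a b.
  by rewrite -(@GE _ _ n.-1 1) ?(@merges_eval _ _ c n.-1 1) //; lia.
have Gab a b : G a b \in [:: a; b] by have [] := GP a b.
have GE1 a b : Fs (a :: nseq n.-1 b) = G a b by apply: (@GE _ _ 1); lia.
suff GA : associative G.
  have Gaa a : G a a = a by have := Gab a a; rewrite !inE orbb => /eqP.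
  (* Pairing both evaluations makes them collapse to the same constant word, where each returns its
     letter. *)
  exists G; split=> // w sw; pose Phi u := (Fs u, fold1 x0 G u).
  have [a b _ _||//||z _] := @merge_to_constant _ _ n Phi predT w.
  - exists (G a b) => // u v suv; rewrite /Phi (fold1_merges x0 GA (Gaa (G a b)) suv).
    by have [_ ->] := GP a b.
  - by [].
  - lia.
  - exact: all_predT.
  rewrite /Phi eval_nseq => -[-> ->].
  have -> : nseq n z = nseq n.-1.+1 z by rewrite prednK //; lia.
  by rewrite fold1_nseq.
(* By associativity (x y^(n-1)) z^(n-1) = x (y^(n-1) z) z^(n-2). The inner value is [y] or [z]; if
   it is [y], it absorbs the letters [z] after it. *)
move=> x y z; rewrite -[RHS]GE1 -[G x y]GE1.
rewrite (@eval_wordA _ _ _ _ [::] _ _ [:: x] (nseq n.-1 y ++ [:: z]) (nseq n.-2 z) hF.1).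
- rewrite -/(G y z) /=.
  have [] := GP y z; rewrite !inE => /orP[]/eqP -> myz.
    rewrite -GE1; have [n3|n3] := posnP n.-2; first by rewrite n3;
      have -> : n.-1 = 1 by lia.
    have := @merge_runs _ _ _ _ y z y 1 n.-2 [:: x] [::] myz (mem_head _ _) isT n3.
    rewrite /= cats0 => ->; last lia.
    by rewrite cats0; have -> : n.-1 = n.-2.+1 by lia.
  by rewrite /= -GE1; congr (Fs (_ :: _)); case: (n) n2 => [|[]].
- by rewrite /= size_nseq; lia.
- by rewrite /= size_nseq; lia.
- by rewrite size_cat size_nseq /=; lia.
- by rewrite /= size_nseq; lia.
rewrite /=; congr (_ :: _); rewrite -catA; congr (_ ++ _).
by case: (n) n2 => [|[]].
Qed.

End NearlyConstant.

(** * Translation of the hypotheses to words, and restrictions to subsets *)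

Section Bridge.
Variables (T : eqType) (n : nat) (x0 : T) (F : T ^ n -> T).
Local Notation Fs := (eval_word x0 F).

Lemma size_fgraph_ord (x : T ^ n) : size (fgraph x) = n.
Proof. by rewrite size_tuple card_ord. Qed.

Lemma quasitrivialE : quasitrivial F <-> forall w, size w = n -> Fs w \in w.
Proof.
split=> [qF w sw|qF x].
  have [i] := qF [ffun i : 'I_n => nth x0 w i].
  by rewrite /eval_word => ->; rewrite ffunE mem_nth // sw.
have /qF := size_fgraph_ord x; rewrite -eval_fgraph -codom_ffun => /codomP.
by [].
Qed.

Lemma class1E : 0 < n -> class_F 1 F <-> nary_associative F /\ quasitrivial F.
Proof.
move=> n0; split=> [[FA qF]|[FA qF]]; split=> // x; apply: qF.
exists [set Ordinal n0]%SET; first by rewrite cards1.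
by move=> i j; rewrite !inE => /eqP -> /eqP ->.
Qed.

(** This turns condition (c) into a merging rule, the index [i] being the length of the prefix
    before the two letters. *)
Lemma outer_neighbour_dominatesE (Y : set T) :
  outer_neighbour_dominates F Y <->
  forall a b c, [set a; b] `&` ~` Y = [set c] -> merges n Fs a b c.
Proof.
split=> [dom a b c abc u v suv|mrg x i j c ij xij].
  have ltu : size u < n by lia.
  have ltu1 : (size u).+1 < n by lia.
  have nth_i d e : nth x0 (u ++ d :: e :: v) (size u) = d.
    by rewrite nth_cat ltnn subnn.
  have nth_j d e : nth x0 (u ++ d :: e :: v) (size u).+1 = e.
    by rewrite nth_cat ltnNge leqnSn subSnn.
  rewrite [LHS](dom _ (Ordinal ltu) (Ordinal ltu1) c) //=; last first.
    by rewrite !ffunE /= nth_i nth_j.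
  congr F; apply/ffunP => k; rewrite !ffunE -!val_eqE /=.
  case: eqP => [->|/eqP neq_ku] /=; first by rewrite nth_i.
  case: eqP => [->|/eqP neq_ku1] /=; first by rewrite nth_j.
  rewrite !nth_cat; case: ltnP => // le_uk.
  by have -> : k - size u = (k - size u).-2.+2 by lia.
have jn := ltn_ord j.
pose w : seq T := fgraph x; have sw : size w = n by exact: size_fgraph_ord.
have wE k : nth x0 w (k : 'I_n) = x k by rewrite nth_fgraph_ord.
have wcat : w = take i w ++ x i :: x j :: drop j.+1 w.
  rewrite -!wE ij -!drop_nth ?sw ?cat_take_drop //; lia.
have st : size (take i w) = i by rewrite size_take sw ltn_ord.
rewrite [LHS](eval_fgraph x0) -/w wcat (mrg _ _ c xij); last first.
  by rewrite st size_drop sw; lia.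
congr F; apply/ffunP => k; rewrite !ffunE -!val_eqE /= ij.
rewrite nth_cat st; case: (ltngtP k i) => [ltki|ltik|eqki] /=.
- by rewrite ltn_eqF 1?ltnW //= nth_take.
- case: eqP => [->|/eqP neq]; first by rewrite subSnn.
  have -> : k - i = (k - i).-2.+2 by lia.
  by rewrite /= nth_drop -wE; congr nth; lia.
- by rewrite eqki subnn.
Qed.

Lemma at_least_equalE (x : T ^ n) : 2 <= n -> at_least_equal n.-1 x ->
  exists k l : 'I_n, forall j, j != k -> x j = x l.
Proof.
move=> n2 [A cA xA]; have cA' : #|~: A| <= 1.
  by have := cardsC A; rewrite card_ord; lia.
have n0 : 0 < n by lia.
have [l lA] : exists l, l \in A by apply/card_gt0P; lia.
(* At most one index lies outside [A]; it is the exceptional [k]. If there is none, [k] is taken to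
   be [l]. *)
have [k kA|A0] := pickP (mem (~: A)); last first.
  by exists l, l => j _; apply: xA => //; have := A0 j; rewrite !inE => /negPn.
exists k, l => j jk; apply: xA => //.
apply: contraNT jk => jA; apply/eqP.
have jA' : j \in ~: A by rewrite inE.
exact: (card_le1_eqP cA' k j kA jA').
Qed.

Lemma card_ge3P (A : set T) : `I_3 #<= A <->
  exists a b c, [/\ A a, A b, A c & uniq [:: a; b; c]].
Proof.
split=> [/card_leP[f]|[a [b [c [Aa Ab Ac abc]]]]].
  pose g k (lt_k3 : k < 3) : A := f (SigSub (mem_set (lt_k3 : `I_3 k))).
  have gI k l (ltk : k < 3) (ltl : l < 3) : (k != l) -> \val (g k ltk) != \val (g l ltl).
    apply: contraNN => /eqP /val_inj.
    by move=> /(inj (in_setT _) (in_setT _)) [->].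
  exists (\val (g 0 isT)), (\val (g 1 isT)), (\val (g 2 isT)).
  split; try exact: set_valP.
  by rewrite /= !inE negb_or !gI.
pose f k := nth a [:: a; b; c] k.
have f_inj : {in `I_3 &, injective f}.
  move=> k l; rewrite !inE => lk ll /eqP; rewrite /f nth_uniq //.
  by move=> /eqP.
apply: (@card_le_trans _ _ _ (f @` `I_3)).
  by have := inj_card_eq f_inj; rewrite card_eq_le => /andP[].
by apply: subset_card_le => _ [k lk3 <-]; case: k lk3 => [|[|[|]]].
Qed.

Lemma restricts_exists (A : set T) :
    (forall w, size w = n -> {subset w <= A} -> Fs w \in A) ->
  exists H, @restricts_to T n F A H.
Proof.
move=> clA.
have cl (x : set_type A ^ n) : F [ffun i => \val (x i)] \in A.
  rewrite (eval_fgraph x0); apply: clA; first exact: size_fgraph_ord.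
  by move=> y; rewrite -codom_ffun => /codomP[i ->]; rewrite ffunE (valP (x i)).
by exists (fun x => SigSub (cl x)) => x.
Qed.

Lemma eval_restriction (A : set T) H (t0 : set_type A) w :
    restricts_to F H -> size w = n ->
  \val (eval_word t0 H w) = Fs [seq \val t | t <- w].
Proof.
move=> FH sw; rewrite FH; congr F; apply/ffunP => i.
by rewrite !ffunE (nth_map t0) // sw.
Qed.

Lemma restriction_associative (A : set T) H :
  @restricts_to T n F A H -> nary_associative F -> nary_associative H.
Proof.
move=> FH FA x i lti; apply: val_inj.
have E k : \val (nested H x k) = nested F (\val \o x) k.
  rewrite FH; congr F; apply/ffunP => j; rewrite !ffunE.
  do 2![case: ifP => // _].
  by rewrite FH; congr F; apply/ffunP => l; rewrite !ffunE.
by rewrite !E; apply: FA.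
Qed.
End Bridge.

(** * Powers in a monoid, and the neutral elements of its n-ary extension *)

Section Monoid.
Variables (T : Type) (G : T -> T -> T) (e : T).
Hypotheses (GA : associative G) (G1x : left_id e G) (Gx1 : right_id e G).
Local Notation pow k x := (iter k (G x) e).

Lemma powD k l x : pow (k + l) x = G (pow k x) (pow l x).
Proof. by elim: k => [|k IH]; rewrite ?G1x // addSn /= IH GA. Qed.

Lemma powS k x : pow k.+1 x = G (pow k x) x.
Proof. by rewrite -addn1 powD /= Gx1. Qed.

Lemma powM k l x : pow (k * l) x = pow l (pow k x).
Proof. by elim: l => [|l IH]; rewrite ?muln0 // mulnS powD IH. Qed.

Lemma pow1 k : pow k e = e.
Proof. by elim: k => //= k ->; rewrite G1x. Qed.

Lemma pow_comm k x y : G x y = G y x -> G (pow k x) y = G y (pow k x).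
Proof.
by move=> xy; elim: k => [|k IH] /=; rewrite ?G1x ?Gx1 // -GA IH GA xy -GA.
Qed.

Lemma powMn k x y : G x y = G y x -> pow k (G x y) = G (pow k x) (pow k y).
Proof.
move=> xy; elim: k => [|k IH]; first by rewrite /= G1x.
rewrite /= IH -!GA; congr G; rewrite !GA; congr G.
by rewrite pow_comm.
Qed.

Lemma fold1_monoid x0 w : 0 < size w -> fold1 x0 G w = foldl G e w.
Proof. by case: w => //= a w _; rewrite G1x. Qed.

Lemma fold1_nseq_cat x0 p q x y :
  fold1 x0 G (nseq p y ++ x :: nseq q y) = G (pow p y) (G x (pow q y)).
Proof.
have powE k z : foldl G z (nseq k y) = G z (pow k y).
  by elim: k z => [|k IH] z; rewrite ?Gx1 //= IH GA.
rewrite fold1_monoid; last by rewrite size_cat addnS.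
by rewrite foldl_cat /= !powE G1x GA.
Qed.

(** For the least positive [r] that kills, the remainder of [k] modulo [r] kills as well, so it is 0
    by minimality. *)
Lemma exponent_dvdn k : 0 < k -> kills G e k ->
  exists2 r, is_exponent G e r & r %| k.
Proof.
move=> k0 kk; have ex : exists r, (0 < r) && `[< kills G e r >].
  by exists k; rewrite k0; apply/asboolP.
case: (ex_minnP ex) => r /andP[r0 /asboolP kr] rmin; exists r.
  by split=> // s s0 ks; apply: rmin; rewrite s0; apply/asboolP.
have kmod : kills G e (k %% r).
  by move=> x; rewrite -[RHS](kk x) {2}(divn_eq k r) powD mulnC powM kr pow1 G1x.
rewrite /dvdn; have [//|kr0] := posnP (k %% r).
have := rmin (k %% r); rewrite kr0 /= leqNgt ltn_mod r0 => /(_ _)/negP[] //.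
by apply/asboolP.
Qed.

(** Neutrality at the last position, tested on [e], gives y^(n-1) = e. At the second position it
    gives x = y x y^(n-2), and multiplying by [y] on the right yields xy = yx. *)
Lemma neutral_monoidE n (x0 : T) (F : T ^ n -> T) y : 2 <= n ->
    (forall w, size w = n -> eval_word x0 F w = fold1 x0 G w) ->
  neutral F y <-> (forall x, G y x = G x y) /\ pow n.-1 y = e.
Proof.
move=> n2 FE.
have E p q x : p + q + 1 = n -> eval_word x0 F (nseq p y ++ x :: nseq q y) =
    G (pow p y) (G x (pow q y)).
  by move=> pq; rewrite FE ?fold1_nseq_cat // size_cat /= !size_nseq; lia.
split=> [/(neutralE x0) ny|[yC yn]].
  have yn : pow n.-1 y = e.
    have := ny n.-1 0 e ltac:(lia); rewrite E; last lia.
    by rewrite /= !Gx1.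
  split=> // x; have := ny 1 n.-2 x ltac:(lia); rewrite E; last lia.
  rewrite /= Gx1 => yxy; rewrite -[in RHS]yxy -!GA -powS.
  by have -> : n.-2.+1 = n.-1 by [lia]; rewrite yn Gx1.
apply/(neutralE x0) => p q x pq; rewrite E // GA pow_comm // -GA -powD.
by have -> : p + q = n.-1 by [lia]; rewrite yn Gx1.
Qed.
End Monoid.

(** * Reduction to a monoid by a neutral element *)

Definition reduction (T : Type) (n : nat) (x0 : T) (F : T ^ n -> T) (e x y : T) : T :=
  eval_word x0 F (x :: nseq n.-2 e ++ [:: y]).

Section Reduction.
Variables (T : Type) (n : nat) (x0 : T) (F : T ^ n -> T) (e : T).
Hypotheses (n2 : 2 <= n) (FA : nary_associative F) (ne : neutral F e).
Local Notation Fs := (eval_word x0 F).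
Local Notation G := (reduction x0 F e).

(** Both sides are bracketings of x e^(n-2) y e^(n-2) z. *)
Lemma reductionA : associative G.
Proof.
move=> x y z; rewrite /reduction -cat_cons.
rewrite (@eval_wordA _ _ _ _ _ _ [::] [::] (x :: nseq n.-2 e ++ [:: y])
  (nseq n.-2 e ++ [:: z]) FA) //=.
- by rewrite size_cat size_nseq /=; lia.
- by rewrite size_nseq; lia.
- by rewrite size_cat size_nseq /=; lia.
- by rewrite size_cat size_nseq /=; lia.
by rewrite cats0 -catA.
Qed.

Lemma reduction1x : left_id e G.
Proof.
move=> x; rewrite /reduction; have /(neutralE x0) := ne => /(_ n.-1 0 x) /=.
by have -> : n.-1 = n.-2.+1 by [lia]; apply; lia.
Qed.

Lemma reductionx1 : right_id e G.
Proof.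
move=> x; rewrite /reduction; have /(neutralE x0) := ne => /(_ 0 n.-1 x) /=.
have -> : n.-1 = n.-2.+1 by lia.
by rewrite -nseqS_cat cats0; apply; lia.
Qed.

(** Expanding [b] to b e^(n-1) and regrouping, e^k (b e^(n-1)) = (e^k b e^(n-1-k)) e^k = b e^k. *)
Lemma eval_move_neutral u k b v : size u + k + size v + 1 = n ->
  Fs (u ++ nseq k e ++ b :: v) = Fs (u ++ b :: nseq k e ++ v).
Proof.
move=> sz; have /(neutralE x0) neE := ne.
have bE p q : p + q + 1 = n -> Fs (nseq p e ++ b :: nseq q e) = b by apply: neE.
rewrite catA -[X in Fs (_ ++ X :: v)](bE 0 n.-1); last lia.
rewrite (@eval_wordA _ _ _ _ _ _ _ u
  (nseq k e ++ b :: nseq (n.-1 - k) e) (nseq k e ++ v) FA).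
- by rewrite bE //; lia.
- by rewrite /= size_nseq; lia.
- by rewrite size_cat size_nseq; lia.
- by rewrite size_cat /= !size_nseq; lia.
- by rewrite size_cat size_nseq; lia.
have -> : nseq n.-1 e = nseq (n.-1 - k) e ++ nseq k e.
  by rewrite -nseqD; congr nseq; lia.
by rewrite -!catA /= -!catA.
Qed.

Lemma eval_reduction w : size w = n -> Fs w = fold1 x0 G w.
Proof.
case: w => [|a s]; first by move=> /= ?; lia.
(* Padding with [k] letters [e] makes every prefix a full argument list, so the induction can remove
   the last letter. *)
move=> sw; suff foldE : forall s k, size s + k + 1 = n ->
    foldl G a s = Fs (a :: s ++ nseq k e).
  by rewrite /= (foldE s 0) ?cats0 //; rewrite /= in sw; lia.
elim/last_ind => [k|{sw}s b IH k] sz /=.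
  have /(neutralE x0) := ne => /(_ 0 k a) /= -> //.
rewrite size_rcons in sz.
rewrite -cats1 foldl_cat /= (IH k.+1) /reduction; last lia.
(* One [e] passes from the inner word to the block that ends in [b]; this block e^(n-1) b has value
   [b], which then moves in front of the padding. *)
rewrite -[_ :: nseq _ _ ++ _]/([::] ++ _ :: (nseq n.-2 e ++ [:: b])).
rewrite (@eval_wordA _ _ _ _ _ _ _ (a :: s ++ nseq k e) (nseq n.-1 e ++ [:: b]) [::] FA).
- have /(neutralE x0) neE := ne; have /= -> := neE n.-1 0 b; last lia.
  have := @eval_move_neutral (a :: s) k b [::] ltac:(move=> /=; lia).
  by rewrite /= cats0 -!catA.
- by rewrite /= size_cat /= size_nseq; lia.
- by rewrite /= size_cat size_nseq /=; lia.
- by rewrite size_cat size_nseq /=; lia.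
- by rewrite /= size_cat size_nseq; lia.
have -> : n.-1 = n.-2.+1 by lia.
by rewrite /= cats0 -!catA -nseqS_cat.
Qed.
End Reduction.

(** * From near quasitriviality to conditions (a), (b) and (c) *)

Section Forward.
Variables (X : eqType) (n : nat) (x0 : X) (F : X ^ n -> X).
Hypotheses (n2 : 2 <= n) (hF : class_F n.-1 F).
Local Notation Fs := (eval_word x0 F).
Local Notation Y := (neutral_set F).

(** A merge has a non-neutral survivor, and [c] is the only candidate. *)
Lemma merges_outer c a b : c \in [:: a; b] -> c \notin Y ->
  (forall d, d \in [:: a; b] -> d \notin Y -> d = c) -> merges n Fs a b c.
Proof.
move=> cab cY cuniq; have nab : ~ (neutral F a /\ neutral F b).
  move=> [na nb]; move: cY; rewrite notin_setE; apply.
  by move: cab; rewrite !inE => /orP[]/eqP ->.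
have [d dab [mab nd]] := merges_not_neutral x0 n2 hF nab.
by rewrite -(cuniq d dab) // notin_setE.
Qed.

Lemma eval_outer w : size w = n -> has (fun x => x \notin Y) w -> Fs w \in w.
Proof.
move=> sw hw.
have [|w' [sw' sub allw ->]] := merge_absorbed _ sw hw (Phi := Fs).
  move=> a b aY bY; rewrite negbK in bY.
  by split; apply: merges_outer => [|//|d]; rewrite !inE ?eqxx ?orbT //;
    move=> /orP[]/eqP -> //; rewrite bY.
have [a b aY _| |z zw' ->] := merge_to_constant _ sw' _ allw (Phi := Fs).
- have nab : ~ (neutral F a /\ neutral F b).
    by move=> [na _]; move: aY; rewrite notin_setE.
  by have [c cab [mab _]] := merges_not_neutral x0 n2 hF nab; exists c.
- lia.
by rewrite eval_nseq // sub.
Qed.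

Lemma neutral_set_dominates : outer_neighbour_dominates F Y.
Proof.
apply/(outer_neighbour_dominatesE x0) => a b c abc.
have [cab cY] : ([set a; b] `&` ~` Y) c by rewrite abc.
apply: merges_outer.
- by case: cab => ->; rewrite !inE eqxx ?orbT.
- by rewrite notin_setE.
move=> d dab dY; suff : ([set a; b] `&` ~` Y) d by rewrite abc.
split; last by move: dY; rewrite notin_setE.
by move: dab; rewrite !inE => /orP[]/eqP ->; [left|right].
Qed.

Lemma neutral_set_quasitrivial_off : quasitrivial_off F Y.
Proof.
have clZ w : size w = n -> {subset w <= ~` Y} -> Fs w \in w.
  move=> sw sub; apply: eval_outer => //.
  case: w sw sub => [/= n0|a s _ sub]; first lia.
  by have := sub a (mem_head _ _); rewrite in_setC /= => ->.
have [H FH] := restricts_exists (A := ~` Y) (fun w sw sub => sub _ (clZ w sw sub)).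
exists H => //; split; first exact: restriction_associative FH hF.1.
- move=> x; pose y : X ^ n := [ffun i => \val (x i)].
  have : Fs (fgraph y) \in codom y.
    rewrite codom_ffun.
    apply: clZ; first exact: size_fgraph_ord.
    by move=> z; rewrite -codom_ffun => /codomP[i ->]; rewrite ffunE (valP (x i)).
  rewrite -eval_fgraph => /codomP[i yi].
  by exists i; apply: val_inj; rewrite FH yi ffunE.
(* Two neutral elements of the restriction merge in [F] to some [c]. Then a = a b^(n-1) = c =
   a^(n-1) b = b. *)
move=> a b /(neutralE a) na /(neutralE a) nb; apply: val_inj.
have nab : ~ (neutral F (\val a) /\ neutral F (\val b)).
  by move=> [+ _]; have := valP a; rewrite in_setC notin_setE.
have [c cab [mab _]] := merges_not_neutral x0 n2 hF nab.
have HE p q : p + q = n ->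
    \val (eval_word a H (nseq p a ++ nseq q b)) = Fs (nseq p (\val a) ++ nseq q (\val b)).
  move=> pq; rewrite (eval_restriction x0 a FH) ?map_cat ?map_nseq //.
  by rewrite size_cat !size_nseq.
transitivity c.
  have /= := HE 1 n.-1 ltac:(lia); have /= -> := nb 0 n.-1 a ltac:(lia).
  by have /= -> := merges_eval n2 hF mab cab
    (p := 1) (q := n.-1) isT ltac:(lia) ltac:(lia).
have /= := HE n.-1 1 ltac:(lia); have /= -> := na n.-1 0 b ltac:(lia).
by have /= -> := merges_eval n2 hF mab cab (p := n.-1) (q := 1) ltac:(lia) isT ltac:(lia).
Qed.

(** In the reduction at [e], the neutral elements are the central ones killed by n-1, and these form
    a subgroup. Closure is also stated on words because the count of neutral elements relies on
    it. *)
Lemma neutral_set_group : Y !=set0 ->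
  group_extension_on F Y /\ forall w, size w = n -> {subset w <= Y} -> Fs w \in Y.
Proof.
move=> [e ne].
pose G := reduction x0 F e.
have GA : associative G := reductionA x0 e n2 hF.1.
have G1x : left_id e G := reduction1x x0 n2 ne.
have Gx1 : right_id e G := reductionx1 x0 n2 ne.
have FE : forall w, size w = n -> Fs w = fold1 x0 G w := eval_reduction x0 n2 hF.1 ne.
have nE y : neutral F y <-> (forall x, G y x = G x y) /\ iter n.-1 (G y) e = e.
  exact: (neutral_monoidE GA G1x Gx1 y n2 FE).
have Ye : e \in Y by rewrite inE.
have YM x y : x \in Y -> y \in Y -> G x y \in Y.
  rewrite !inE => /nE[xC xn] /nE[yC yn]; apply/nE; split=> [z|].
    by rewrite -GA (yC z) GA (xC z) -GA.
  by rewrite powMn // xn yn.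
have clY w : size w = n -> {subset w <= Y} -> Fs w \in Y.
  move=> sw sub; rewrite FE // (fold1_monoid G1x); last by rewrite sw; lia.
  elim: w (e) Ye sub {sw} => //= a w IH b Yb sub.
  apply: IH; last by move=> c cw; apply: sub; rewrite inE cw orbT.
  by apply: YM => //; apply: sub; rewrite mem_head.
have YX x k : x \in Y -> iter k (G x) e \in Y.
  by move=> Yx; elim: k => //= k IH; apply: YM.
split=> //; have [H FH] := restricts_exists clY; exists H => //.
pose GT (s t : set_type Y) : set_type Y := SigSub (YM _ _ (valP s) (valP t)).
pose eT : set_type Y := SigSub Ye.
have val_pow k (s : set_type Y) : \val (iter k (GT s) eT) = iter k (G (\val s)) e.
  by elim: k => //= k ->.
have GTA : associative GT by move=> s t u; apply: val_inj; apply: GA.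
have GT1 : left_id eT GT by move=> s; apply: val_inj; apply: G1x.
have kT : kills GT eT n.-1.
  move=> s; apply: val_inj; rewrite val_pow.
  by have := valP s; rewrite inE => /nE[].
have [r rexp rn] := exponent_dvdn GTA GT1 (ltac:(lia) : 0 < n.-1) kT.
exists GT, eT, r; split=> //.
  split=> //.
    move=> s t; apply: val_inj; have := valP s; rewrite inE => /nE[sC _].
    exact: sC.
  (* The inverse of [s] is s^(n-2), as s^(n-1) = e. *)
  exists (fun s => SigSub (YX (\val s) n.-2 (valP s))) => s; apply: val_inj.
  rewrite /= -(powS GA G1x Gx1).
  have -> : n.-2.+1 = n.-1 by lia.
  by have := valP s; rewrite inE => /nE[].
move=> x; apply: val_inj; rewrite (binary_iterE eT GTA).
rewrite (eval_mkseq eT) (eval_restriction x0 eT FH) ?size_mkseq //.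
rewrite FE ?size_map ?size_iota //.
rewrite prednK; last lia.
have val_fold t s : \val (foldl GT t s) = foldl G (\val t) (map \val s).
  by elim: s t => //= a s IH t; rewrite IH.
have : 0 < size (mkseq x n) by rewrite size_mkseq; lia.
by case: (mkseq x n) => //= a s _; rewrite val_fold.
Qed.

(** A word whose value is not among its letters has only neutral letters, and it is not constant.
    Two distinct letters and the value, neutral by closure, are the three elements. *)
Lemma neutral_set_card3 : ~ class_F 1 F ->
  exists a b c, [/\ Y a, Y b, Y c & uniq [:: a; b; c]].
Proof.
move=> nF1.
have [w [sw Fw]] : exists w, size w = n /\ Fs w \notin w.
  apply: contra_notP nF1 => nw; apply/(class1E _ (ltnW n2)); split; first exact: hF.1.
  apply/(quasitrivialE x0) => w sw; apply: contra_notT nw => Fw.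
  by exists w.
have subY : {subset w <= Y}.
  move=> a aw; apply: contraNT Fw => aY; apply: eval_outer => //.
  by apply/hasP; exists a.
have [a aw] : exists a, a \in w.
  case: (w) sw => [/= ?|a s _]; first lia.
  by exists a; rewrite mem_head.
have /set_mem na := subY a aw.
have [_ clY] := neutral_set_group (ex_intro _ a na).
have [b bw ab] : exists2 b, b \in w & b != a.
  apply/hasP; apply: contraNT Fw => /hasPn wa.
  have wE : w = nseq (size w) a by apply/all_pred1P/allP => b /wa /negPn.
  by rewrite wE sw eval_nseq // -sw -wE.
exists a, b, (Fs w); split=> //.
- exact/set_mem/subY.
- exact/set_mem/clY.
rewrite /= !inE negb_or eq_sym ab andbT /=; apply/andP; split.
  by apply: contraNneq Fw => <-.
by apply: contraNneq Fw => <-.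
Qed.

Lemma near_quasitrivial_structure : ~ class_F 1 F ->
  [/\ `I_3 #<= Y, group_extension_on F Y, quasitrivial_off F Y &
      outer_neighbour_dominates F Y].
Proof.
move=> /neutral_set_card3 Y3; have [a [_ [_ [na _ _ _]]]] := Y3.
have [gY _] := neutral_set_group (ex_intro _ a na).
split=> //; first exact/card_ge3P.
  exact: neutral_set_quasitrivial_off.
exact: neutral_set_dominates.
Qed.
End Forward.

(** * From conditions (a), (b) and (c) back to near quasitriviality *)

Section Converse.
Variables (X : eqType) (n : nat) (x0 : X) (F : X ^ n -> X) (Y : set X).
Hypotheses (n2 : 2 <= n).
Local Notation Fs := (eval_word x0 F).

Section OuterQuasitrivial.
Variable HZ : set_type (~` Y) ^ n -> set_type (~` Y).
Hypotheses (FHZ : restricts_to F HZ) (HZA : nary_associative HZ).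
Hypotheses (HZq : quasitrivial HZ) (HZ1 : is_subset1 (neutral_set HZ)).
Hypothesis dom : outer_neighbour_dominates F Y.

Lemma outer_val x : x \notin Y -> exists t : set_type (~` Y), x = \val t.
Proof.
move=> xY; have xZ : x \in ~` Y by rewrite in_setC.
by exists (SigSub xZ).
Qed.

Lemma outer_vals w : all (fun x => x \notin Y) w ->
  exists ts : seq (set_type (~` Y)), w = map \val ts.
Proof.
elim: w => [|x w IH] /=; first by exists [::].
by move=> /andP[/outer_val[t ->] /IH[ts ->]]; exists (t :: ts).
Qed.

Lemma outer_merges a b : a \notin Y -> b \in Y ->
  merges n Fs a b a /\ merges n Fs b a a.
Proof.
move=> aY bY; have mrg := (outer_neighbour_dominatesE x0 F Y).1 dom.
rewrite notin_setE in aY; rewrite inE in bY.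
by split; apply: mrg; apply/seteqP; split=> [d [[] -> //]|d ->]; split => //;
  [left|right].
Qed.

Lemma eval_all_outer w : size w = n -> all (fun x => x \notin Y) w -> Fs w \in w.
Proof.
move=> sw /outer_vals[ts wE]; rewrite wE in sw *; rewrite size_map in sw.
case: ts sw {wE} => [/= ?|t ts sw]; first lia.
rewrite -(eval_restriction x0 t FHZ) // map_f //.
by have := (quasitrivialE t HZ).1 HZq => /(_ _ sw).
Qed.

(** Letters of [Y] are absorbed first by (c); the word left lies outside [Y], where the operation is
    quasitrivial. *)
Lemma eval_some_outer w : size w = n -> has (fun x => x \notin Y) w ->
  exists2 z, z \in w & z \notin Y /\ Fs w = z.
Proof.
move=> sw hw.
have [a b aY|w' [sw' sub allw ->]] := merge_absorbed _ sw hw (Phi := Fs).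
  by rewrite negbK; apply: outer_merges.
have zw' := eval_all_outer sw' allw; exists (Fs w'); first exact: sub.
by split=> //; apply: (allP allw).
Qed.

Lemma eval_single_outer a w : size w = n -> a \in w -> a \notin Y ->
  (forall d, d \in w -> d \notin Y -> d = a) -> Fs w = a.
Proof.
move=> sw aw aY auniq; have [|z zw [zY ->]] := eval_some_outer sw.
  by apply/hasP; exists a.
exact: auniq.
Qed.

(** Distinct letters always merge, since the other alternative gives two different neutral elements.
    A point [t0] is assumed because the outer part may be empty. *)
Lemma outer_reducible (t0 : set_type (~` Y)) : exists G, [/\ associative G,
    forall a b, G a b \in [:: a; b],
    forall a b, eval_word t0 HZ (nseq n.-1 a ++ [:: b]) = G a b &
    forall w, size w = n -> eval_word t0 HZ w = fold1 t0 G w].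
Proof.
have hHZ : class_F n.-1 HZ by split.
apply: (reducible_of_merges n2 hHZ) => a b.
have [ab|neq_ab] := eqVneq a b.
  by exists a; [exact: mem_head|rewrite ab; apply: merges_refl].
have [m|m|[na nb]] := merges_or_neutral t0 n2 hHZ neq_ab.
- by exists a => //; apply: mem_head.
- by exists b => //; rewrite !inE eqxx orbT.
- by move: neq_ab; rewrite (HZ1 na nb) eqxx.
Qed.
End OuterQuasitrivial.

Hypotheses (gY : group_extension_on F Y) (qZ : quasitrivial_off F Y).
Hypotheses (dom : outer_neighbour_dominates F Y).

Lemma group_part : exists (G : set_type Y -> set_type Y -> set_type Y) e,
  [/\ abelian_group G e, kills G e n.-1 & forall t w, size w = n ->
    Fs (map \val w) = \val (fold1 t G w)].
Proof.
have [H FH [G [e [r [gG [r0 kr _] rn HG]]]]] := gY; exists G, e; split=> //.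
  have [GA _ G1 _] := gG.
  move=> x; have /dvdnP[q ->] := rn.
  by rewrite mulnC (powM GA G1) kr (pow1 G1).
move=> t w sw; have [GA _ _ _] := gG.
rewrite -(eval_restriction x0 t FH) //; congr (\val _).
by rewrite /eval_word HG (binary_iterE t GA) prednK -?sw ?mkseq_nth //; lia.
Qed.

(** The binary operation [R] is the group law on [Y], an associative idempotent law outside, and
    outer arguments absorb inner ones. Once [F] is its extension, associativity of [F] follows. *)
Lemma reduced : exists (G : set_type Y -> set_type Y -> set_type Y) e,
  [/\ abelian_group G e,
      forall s t, reduction x0 F (\val e) (\val s) (\val t) = \val (G s t),
      forall y, y \in Y -> neutral F y & nary_associative F].
Proof.
have [HZ FHZ [HZA HZq HZ1]] := qZ.
have [G [e [gG kG YF]]] := group_part; exists G, e.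
have [GA GC G1 Ginv] := gG.
have Gx1 : right_id e G by move=> t; rewrite GC.
have eY : \val e \in Y := valP e.
pose R := reduction x0 F (\val e).
have RY s t : R (\val s) (\val t) = \val (G s t).
  have -> : R (\val s) (\val t) = Fs (map \val (s :: nseq n.-2 e ++ [:: t])).
    by rewrite /= map_cat map_nseq.
  rewrite (YF e); last by rewrite /= size_cat size_nseq /=; lia.
  rewrite /= foldl_cat /=; congr (\val (G _ _)).
  by elim: (n.-2) => //= k IH; rewrite Gx1.
have single := eval_single_outer FHZ HZq dom.
have Rzy z y : z \notin Y -> y \in Y -> R z y = z.
  move=> zY yY; apply: single => //.
  - by rewrite /= size_cat size_nseq /=; lia.
  - by rewrite mem_head.
  move=> d; rewrite inE mem_cat mem_seq1 => /or3P[/eqP //|/nseqP[->]|/eqP->].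
    by rewrite eY.
  by rewrite yY.
have Ryz y z : z \notin Y -> y \in Y -> R y z = z.
  move=> zY yY; apply: single => //.
  - by rewrite /= size_cat size_nseq /=; lia.
  - by rewrite inE mem_cat mem_seq1 eqxx !orbT.
  move=> d; rewrite inE mem_cat mem_seq1 => /or3P[/eqP->|/nseqP[->]|/eqP//].
    by rewrite yY.
  by rewrite eY.
have RYY x y : x \in Y -> y \in Y -> R x y \in Y.
  by move=> xY yY; rewrite (RY (SigSub xY) (SigSub yY)); apply: valP.
have RYA x y z : x \in Y -> y \in Y -> z \in Y -> R x (R y z) = R (R x y) z.
  move=> xY yY zY.
  have := RY (SigSub xY) (SigSub yY); have := RY (SigSub yY) (SigSub zY).
  by rewrite /= => -> ->; rewrite !(RY (SigSub xY), RY _ (SigSub zY)) GA.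
have Rzz (t0 : set_type (~` Y)) : exists GZ, [/\ associative GZ, 
   forall a b, R (\val a) (\val b) = \val (GZ a b), forall a, GZ a a = a &
   forall w, size w = n -> Fs (map \val w) = \val (fold1 t0 GZ w)].
  have [GZ [GZA GZq GZE GZf]] := outer_reducible HZA HZq HZ1 t0.
  exists GZ; split=> // [a b|a|w sw]; first 2 last.
  - by rewrite -(eval_restriction x0 t0 FHZ) // GZf.
  - rewrite -GZE (eval_restriction x0 t0 FHZ); last by rewrite size_cat size_nseq /=; lia.
    (* [R] pads with [e] and [GZ] with [a]; the leading [a] absorbs the letters [e]. *)
    rewrite map_cat map_nseq /= /R /reduction.
    have [n0|n0] := posnP n.-2; first by rewrite n0; have -> : n.-1 = 1 by lia.
    have aY : \val a \notin Y by have := valP a; rewrite in_setC.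
    have [m _] := outer_merges dom aY eY.
    have := merge_runs (k := 1) (u := [::]) (v := [:: \val b]) m (mem_head _ _) isT n0.
    by rewrite /= => ->; [have -> : n.-1 = n.-2.+1 by lia|lia].
  - by have := GZq a a; rewrite !inE orbb => /eqP.
have RZZ x y : x \notin Y -> y \notin Y -> R x y \notin Y.
  move=> /outer_val[s ->] /outer_val[t ->].
  have [GZ [_ -> _ _]] := Rzz s.
  by have := valP (GZ s t); rewrite in_setC.
have RZA x y z : x \notin Y -> y \notin Y -> z \notin Y -> R x (R y z) = R (R x y) z.
  move=> /outer_val[s ->] /outer_val[t ->] /outer_val[u ->].
  by have [GZ [GZA RE _ _]] := Rzz s; rewrite !RE GZA.
(* In the mixed cases the arguments in [Y] are absorbed, and both sides are the product of the outer
   arguments. *)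
have RA : associative R.
  move=> x y z; have [xY|xY] := boolP (x \in Y); have [yY|yY] := boolP (y \in Y);
    have [zY|zY] := boolP (z \in Y).
  - exact: RYA.
  - by rewrite (Ryz y) // (Ryz x) // Ryz // RYY.
  - by rewrite (Rzy y) // Ryz // Rzy.
  - by rewrite (Ryz x y) // (Ryz x) // RZZ.
  - by rewrite (Rzy x y) // (Rzy x z) // Rzy // RYY.
  - by rewrite (Ryz y) // (Rzy x y).
  - by rewrite (Rzy y) // (Rzy (R x y)) // RZZ.
  - exact: RZA.
have FR w : size w = n -> Fs w = fold1 x0 R w.
  move=> sw; have [hw|] := boolP (has (fun x => x \notin Y) w); last first.
    rewrite -all_predC => /allP wY;
      have {wY}[ts wE] : exists ts : seq (set_type Y), w = map \val ts.
      elim: w wY {sw} => [|a w IH] wY; first by exists [::].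
      have [|ts ->] := IH; first by move=> d dw; apply: wY; rewrite inE dw orbT.
      have /negPn aY := wY a (mem_head _ _).
      by exists (SigSub aY :: ts).
    rewrite wE in sw *; rewrite size_map in sw; rewrite (YF e) //.
    case: ts sw {wE} => [/= ?|t ts _ /=]; first lia.
    by elim: ts t => //= u ts IH t; rewrite RY IH.
  (* Both evaluations absorb the letters of [Y] in the same way, so it suffices to compare them on
     one word of outer letters. *)
  pose Phi u := (Fs u, fold1 x0 R u).
  have Raa a : a \notin Y -> R a a = a.
    by move=> /outer_val[t ->]; have [GZ [_ -> -> _]] := Rzz t.
  have [a b aY|w' [sw' sub allw]] := merge_absorbed _ sw hw (Phi := Phi).
    rewrite negbK => bY; have [mab mba] := outer_merges dom aY bY.
    split=> u v suv; rewrite /Phi.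
      rewrite mab //; have := @fold1_merges _ x0 _ RA n a b.
      by rewrite (Rzy a b) // Raa // => ->.
    rewrite mba //; have := @fold1_merges _ x0 _ RA n b a.
    by rewrite (Ryz b a) // Raa // => ->.
  rewrite /Phi => -[-> ->]; have [ts wE] := outer_vals allw.
  rewrite wE in sw' *; rewrite size_map in sw'.
  case: ts sw' {wE} => [/= ?|t ts sw']; first lia.
  have [GZ [_ RE _ ->//]] := Rzz t.
  by rewrite /=; elim: ts t {sw'} => //= u ts IH t; rewrite RE IH.
have FA : nary_associative F by apply: associative_of_fold1 RA FR; lia.
(* An outer [x] absorbs the letters [y]; for [x] in [Y], commutativity turns y^p x y^q into x
   y^(n-1) = x. *)
split=> // y yY; apply/(neutralE x0) => p q x pq.
have sz (T : Type) (a b : T) : size (nseq p a ++ b :: nseq q a) = n.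
  by rewrite size_cat /= !size_nseq; lia.
have [xY|xY] := boolP (x \in Y); last first.
  apply: single => //; first by rewrite mem_cat mem_head orbT.
  move=> d; rewrite mem_cat inE => /or3P[/nseqP[->]|/eqP//|/nseqP[->]];
  by rewrite yY.
pose s : set_type Y := SigSub yY; pose t : set_type Y := SigSub xY.
have -> : nseq p y ++ x :: nseq q y = map \val (nseq p s ++ t :: nseq q s).
  by rewrite map_cat /= !map_nseq.
rewrite (YF e) // (fold1_nseq_cat GA G1 Gx1).
rewrite GC -GA -(powD GA G1) addnC.
by have -> : p + q = n.-1 by [lia]; rewrite kG Gx1.
Qed.

Lemma structure_near_quasitrivial : `I_3 #<= Y ->
  [/\ class_F n.-1 F, ~ class_F 1 F & neutral_set F = Y].
Proof.
move=> /card_ge3P[a [b [c [aY bY cY abc]]]].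
have [G [e [gG RY nY FA]]] := reduced; have [GA GC G1 [inv Ginv]] := gG.
have [HZ FHZ [HZA HZq HZ1]] := qZ.
split.
- split=> // x xeq.
  pose w : seq X := codom x.
  have [hw|nhw] := boolP (has (fun x => x \notin Y) (codom x)).
    have [|z] := eval_some_outer FHZ HZq dom _ hw.
      by rewrite codom_ffun; apply: size_fgraph_ord.
    by rewrite codom_ffun -eval_fgraph -codom_ffun => /codomP[i ->] [_ ->]; exists i.
  have xY i : x i \in Y.
    by move: nhw; rewrite -all_predC => /allP/(_ (x i) (codom_f x i)) /negPn.
  (* All arguments but the one at [k] equal [x l], which is neutral because it lies in [Y]; hence
     the value is [x k]. *)
  have [k [l xl]] := at_least_equalE n2 xeq; exists k.
  rewrite -[RHS](nY _ (xY l) (x k) k); congr F; apply/ffunP => j; rewrite ffunE.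
  by case: eqVneq => [->|/xl].
- move=> /(class1E _ (ltnW n2))[_ qF].
  have RE (s t : set_type Y) : \val (G s t) \in [:: \val s; \val t; \val e].
    have /((quasitrivialE x0 F).1 qF) :
        size (\val s :: nseq n.-2 (\val e) ++ [:: \val t]) = n.
      by rewrite /= size_cat size_nseq /=; lia.
    rewrite -/(reduction x0 F _ _ _) RY inE mem_cat mem_seq1.
    by move=> /or3P[/eqP->|/nseqP[->]|/eqP->]; rewrite !inE eqxx ?orbT.
  (* Quasitriviality of F(s, e, ..., e, t) leaves st in {s, t, e}, and cancellation excludes [s] and
     [t]. *)
  have {}RE (s t : set_type Y) : s != e -> t != e -> G s t = e.
    have cancel u v : G u v = u -> v = e.
      by move=> uv; rewrite -[LHS]G1 -(Ginv u) -GA uv.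
    move=> se te; have := RE s t; rewrite !inE !val_eqE => /or3P[]/eqP // st.
      by rewrite (cancel _ _ st) eqxx in te.
    by rewrite GC in st; rewrite (cancel _ _ st) eqxx in se.
  have [s [t [st se te]]] : exists s t : set_type Y, [/\ s != t, s != e & t != e].
    have [aE bE cE] := And3 (mem_set aY) (mem_set bY) (mem_set cY).
    move: abc; rewrite /= !inE negb_or andbT => /andP[/andP[ab ac] bc].
    have [ae|ae] := eqVneq (SigSub aE) e.
      by exists (SigSub bE), (SigSub cE);
        rewrite -ae -!val_eqE /= eq_sym (eq_sym c) in ab *; split.
    have [be|be] := eqVneq (SigSub bE) e.
      by exists (SigSub aE), (SigSub cE); rewrite -be -!val_eqE /= (eq_sym c); split.
    by exists (SigSub aE), (SigSub bE); rewrite -val_eqE.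
  (* Since ss = st = e, we get s = s(st) = (ss)t = t. *)
  have := GA s s t; rewrite (RE s s) // (RE s t) // G1 GC G1 => ts.
  by rewrite ts eqxx in st.
apply/seteqP; split=> y; last by move=> yY; apply: nY; rewrite inE.
(* A neutral [y] outside [Y] would give y^(n-1) a = a, whereas [y], the only outer letter of this
   word, is its value. *)
move=> ny; have [|yY] := boolP (y \in Y); first by rewrite inE.
have /(neutralE x0) := ny => /(_ n.-1 0 a ltac:(lia)).
rewrite (eval_single_outer FHZ HZq dom (a := y)) //.
- by move=> ya; move: yY; rewrite ya notin_setE.
- by rewrite size_cat size_nseq /=; lia.
- by rewrite mem_cat mem_nseq eqxx andbT; apply/orP; left; lia.
by move=> d; rewrite mem_cat mem_seq1 => /orP[/nseqP[-> //]|/eqP->]; rewrite notin_setE.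
Qed.
End Converse.

Theorem theorem1p8 (X : Type) (n : nat) (F : X ^ n -> X)
    (hX : `I_3 #<= [set: X]) (hn : 2 <= n) :
  (class_F n.-1 F -> ~ class_F 1 F ->
     [/\ `I_3 #<= neutral_set F,
         group_extension_on F (neutral_set F),
         quasitrivial_off F (neutral_set F) &
         outer_neighbour_dominates F (neutral_set F)]) /\
  (forall Y : set X, `I_3 #<= Y ->
     group_extension_on F Y -> quasitrivial_off F Y ->
     outer_neighbour_dominates F Y ->
     [/\ class_F n.-1 F, ~ class_F 1 F & neutral_set F = Y]).
Proof.
(* [{classic X}] supplies the decidable equality that the lemmas on words assume, and an element of
   [X] the default letter. *)
have [x0 _] := (@card_ge3P {classic X} _).1 hX.
split=> [hF nF1|Y Y3 gY qY dom].
  exact: (@near_quasitrivial_structure {classic X} n x0 F hn hF nF1).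
exact: (@structure_near_quasitrivial {classic X} n x0 F Y hn gY qY dom Y3).
Qed.
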